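(* Let $n$ and $N$ be positive integers and let $p$ be a prime number such that $p\nmid N$. Let $S$ be a finite set of polynomial maps $$f=(f_1,\ldots,f_n):\mathbb{Z}[1/N]^n\to\mathbb{Z}[1/N]^n$$ where each $f_i$ is of the form $$f_i(x_1,\ldots,x_n)=x_i+p\cdot g_i(x_1,\ldots,x_n)+h_i(x_1^p,\ldots,x_n^p)$$ for some $g_i,h_i\in\mathbb{Z}[1/N][x_1,\ldots,x_n]$. Then there exists an effective constant $C=C(n,N)$, depending only on $n$ and $N$, such that $$|\mathcal{O}_S(x)|\leq (Cp^n|S|+1)^{Cp^n-1}$$ for all $S$-finite points $x\in\mathbb{Z}[1/N]^n$.
   Context: For a set $Y$ and a set $S$ of self-maps of $Y$, let $\langle S\rangle$ be the monoid generated by $S$ under composition (containing the identity), and let $\mathcal{O}_S(x)=\{f(x): f\in\langle S\rangle\}$ for $x\in Y$. The point $x$ is $S$-finite if $\mathcal{O}_S(x)$ is a finite set. ''Effective'' means that the constant can be computed by an algorithm from the data it depends on (here $n$ and $N$). *)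

(* Defs.v *)
From HB Require Import structures.
From mathcomp Require Import all_boot all_order all_algebra.
From mathcomp Require Import finmap.
From mathcomp Require Import boolp classical_sets functions cardinality.
From mathcomp Require Import mpoly.

Set Implicit Arguments.
Unset Strict Implicit.
Unset Printing Implicit Defensive.

Import Order.TTheory GRing.Theory Num.Theory.
Local Open Scope ring_scope.

(* For N = 0 the convention 0^-1 = 0 makes this the ring of integers. *)
Definition Zloc_pred (N : nat) : {pred rat} :=
  fun x => `[< exists (a : int) (k : nat), x = a%:~R / N%:R ^+ k >].

Fact Zloc_subring (N : nat) : subring_closed (Zloc_pred N).
Proof.
have [->|N0] := eqVneq N 0%N.
  have E (x : rat) : x \in Zloc_pred 0 <-> exists a : int, x = a%:~R.
    split=> [/asboolP[a [[|k] ->]]|[a ->]].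
    - by exists a; rewrite expr0 divr1.
    - by exists 0; rewrite exprS mul0r invr0 mulr0.
    - by apply/asboolP; exists a, 0%N; rewrite expr0 divr1.
  split; first by apply/E; exists 1.
    by move=> x y /E[a ->] /E[b ->]; apply/E; exists (a - b); rewrite intrB.
  by move=> x y /E[a ->] /E[b ->]; apply/E; exists (a * b); rewrite intrM.
have NX k : (N%:R ^+ k : rat) != 0 by rewrite expf_neq0 // pnatr_eq0.
split; first by apply/asboolP; exists 1, 0%N; rewrite expr0 divr1.
  move=> x y /asboolP[a [k ->]] /asboolP[b [l ->]]; apply/asboolP.
  exists (a * N%:Z ^+ l - b * N%:Z ^+ k), (k + l)%N.
  rewrite intrB !intrM !rmorphXn /= -!pmulrn exprD -mulNr addf_div //.
  by rewrite mulNr.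
move=> x y /asboolP[a [k ->]] /asboolP[b [l ->]]; apply/asboolP.
by exists (a * b), (k + l)%N; rewrite intrM exprD mulf_div.
Qed.

HB.instance Definition _ (N : nat) :=
  GRing.isSubringClosed.Build rat (Zloc_pred N) (Zloc_subring N).

(* The ring Z[1/N], as a subring of rat. *)
Record Zloc (N : nat) := MkZloc { Zloc_val : rat; _ : Zloc_val \in Zloc_pred N }.

HB.instance Definition _ (N : nat) := [isSub for @Zloc_val N].
HB.instance Definition _ (N : nat) := [Choice of Zloc N by <:].
HB.instance Definition _ (N : nat) :=
  [SubChoice_isSubComNzRing of Zloc N by <:].

Definition Zaff (N n : nat) : Type := {ffun 'I_n -> Zloc N}.
HB.instance Definition _ (N n : nat) := Choice.on (Zaff N n).

Inductive monoid_gen (Y : choiceType) (S : {fset (Y -> Y)}) : (Y -> Y) -> Prop :=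
| monoid_gen_id : monoid_gen S id
| monoid_gen_in f : f \in S -> monoid_gen S f
| monoid_gen_comp f g :
    monoid_gen S f -> monoid_gen S g -> monoid_gen S (f \o g).

Definition gen_orbit (Y : choiceType) (S : {fset (Y -> Y)}) (x : Y) : set Y :=
  [set y | exists2 f, monoid_gen S f & y = f x]%classic.

Definition S_finite (Y : choiceType) (S : {fset (Y -> Y)}) (x : Y) : Prop :=
  finite_set (gen_orbit S x).

Definition admissible (N n p : nat) (f : Zaff N n -> Zaff N n) : Prop :=
  forall i : 'I_n, exists g h : {mpoly (Zloc N)[n]}, forall x : Zaff N n,
    f x i = x i + p%:R * g.@[x] + h.@[fun j => x j ^+ p].

(* Total recursive functions: minimization is only applied to functions having
   a zero on every input. [recursive_ext] makes the predicate extensional. *)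
Inductive recursive : forall k : nat, (k.-tuple nat -> nat) -> Prop :=
| recursive_zero k : recursive (fun _ : k.-tuple nat => 0%N)
| recursive_succ : recursive (fun v : 1.-tuple nat => (thead v).+1)
| recursive_proj k (i : 'I_k) : recursive (fun v : k.-tuple nat => tnth v i)
| recursive_comp k m (g : m.-tuple nat -> nat) (h : 'I_m -> k.-tuple nat -> nat) :
    recursive g -> (forall i, recursive (h i)) ->
    recursive (fun v => g [tuple h i v | i < m])
| recursive_prim k (f : k.-tuple nat -> nat) (g : k.+2.-tuple nat -> nat) :
    recursive f -> recursive g ->
    recursive (fun v : k.+1.-tuple nat =>
      nat_rect (fun=> nat) (f (behead_tuple v))
        (fun y r => g (cons_tuple y (cons_tuple r (behead_tuple v)))) (thead v))
| recursive_mu k (f : k.+1.-tuple nat -> nat)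
    (f0 : forall v : k.-tuple nat, exists y, f (cons_tuple y v) == 0%N) :
    recursive f -> recursive (fun v => ex_minn (f0 v))
| recursive_ext k (f g : k.-tuple nat -> nat) :
    recursive f -> f =1 g -> recursive g.

Definition computable2 (C : nat -> nat -> nat) : Prop :=
  recursive (fun v : 2.-tuple nat => C (tnth v ord0) (tnth v ord_max)).

(* Main.v *)
(** A word in S is a polynomial map whose Jacobian J is congruent to 1 modulo p,
  so it is injective on residue classes modulo p, and it permutes the points of
  a finite orbit that it keeps in their class. If F y = y + p^k d with k > 0 and
  p not dividing d, then the j-th iterate of F sends y to y + p^k j d modulo
  p^(k+1); hence a cycle of prime length inside a class has length p.

  Let q be a prime not dividing N, with q <= N + 1. If p > q^n, such a cycle is
  a fixed point: modulo each q^(k+1) it would otherwise be a cycle of prime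
  length > q^n on at most q^n classes. So a word mapping a point of the orbit
  to its class modulo p fixes it. If p <= q^n, write J = 1 + p A modulo p^2. A word
  with A = 0 modulo p which preserves the class of y modulo p^2 fixes y,
  because the expansion above then holds modulo p^(k+2). As A is additive under
  composition, its sum along a path together with the class of the point
  modulo p^2 take at most p^(2n+n^2) <= C p^n values.

  In both cases, a shortest path from x to a point of its orbit never repeats
  such a label, so its length is less than the number M of labels, and the orbit
  has at most (|S| + 1)^(M - 1) points. *)

Require Import Defs.
From HB Require Import structures.
From mathcomp Require Import all_boot all_order all_algebra.
From mathcomp Require Import finmap.
From mathcomp Require Import boolp classical_sets functions cardinality.
From mathcomp Require Import mpoly.
From mathcomp Require Import zify ring.

Set Implicit Arguments.
Unset Strict Implicit.
Unset Printing Implicit Defensive.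

Import Order.TTheory GRing.Theory Num.Theory.
Local Open Scope ring_scope.

(** * Pigeonhole and prime periods of iterates *)

Lemma pigeonhole_nat (T : finType) (f : nat -> T) :
  exists i j, (i < j <= #|T|)%N /\ f i = f j.
Proof.
have /injectivePn[a [b ab fab]] : ~~ injectiveb (fun i : 'I_#|T|.+1 => f i).
  by apply/negP => /injectiveP /leq_card; rewrite card_ord ltnn.
have /orP[lt|lt] : (a < b)%N || (b < a)%N by rewrite -neq_ltn.
  by exists a, b; rewrite lt -ltnS ltn_ord.
by exists b, a; rewrite lt -ltnS ltn_ord.
Qed.

Lemma iter_fix (T : Type) (f : T -> T) (x : T) m k :
  iter m f x = x -> iter (k * m) f x = x.
Proof. by move=> fx; elim: k => [//|k IH]; rewrite mulSn iterD IH. Qed.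

(** With [k > 1] the minimal period of [x], the iterate of exponent [k / pdiv k] moves [x] along a
    cycle of prime length [pdiv k]. *)
Lemma iter_prime_period (T : Type) (f : T -> T) (x : T) m :
  (0 < m)%N -> iter m f x = x -> f x <> x ->
  exists s l, [/\ prime l, iter s f x <> x & iter l (iter s f) x = x].
Proof.
move=> m0 fm nfx.
have ex : exists m, (0 < m)%N && `[< iter m f x = x >].
  by exists m; rewrite m0; apply/asboolP.
case: (ex_minnP ex) => k /andP[k0 /asboolP fk] kmin.
have k1 : (1 < k)%N by move: k k0 fk {kmin} => [|[|k]].
have pl := pdiv_prime k1.
exists (k %/ pdiv k)%N, (pdiv k); split => //.
  move=> fs; have : (k <= k %/ pdiv k)%N.
    apply: kmin; rewrite divn_gt0 ?pdiv_gt0 // dvdn_leq ?pdiv_dvd //=.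
    exact/asboolP.
  by rewrite leqNgt ltn_Pdiv ?prime_gt1.
by rewrite -iterM mulnC divnK ?pdiv_dvd.
Qed.

(** * Congruences in a module and first-order expansions of maps *)

Section Jets.
Variables (R : comNzRingType) (V : lmodType R).
Implicit Types (c P : R) (x y u t : V) (F G : V -> V).

Definition eqm c x y := exists t, y = x + c *: t.

Lemma eqm_refl c x : eqm c x x.
Proof. by exists 0; rewrite scaler0 addr0. Qed.

Lemma eqm_add c x t : eqm c x (x + c *: t).
Proof. by exists t. Qed.

Lemma eqm_sym c x y : eqm c x y -> eqm c y x.
Proof. by move=> [t ->]; exists (- t); rewrite scalerN addrK. Qed.

Lemma eqm_trans c x y z : eqm c x y -> eqm c y z -> eqm c x z.
Proof. by move=> [t ->] [s ->]; exists (t + s); rewrite scalerDr addrA. Qed.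

Lemma eqmD c x y x' y' : eqm c x y -> eqm c x' y' -> eqm c (x + x') (y + y').
Proof. by move=> [t ->] [s ->]; exists (t + s); rewrite scalerDr addrACA. Qed.

Lemma eqmZ d c x y : eqm c x y -> eqm (d * c) (d *: x) (d *: y).
Proof. by move=> [t ->]; exists t; rewrite scalerDr scalerA. Qed.

Lemma eqmW d c x y : eqm (d * c) x y -> eqm c x y.
Proof. by move=> [t ->]; exists (d *: t); rewrite scalerA (mulrC c). Qed.

Lemma eqm0_sum_nat c (E : nat -> V) i j : (i <= j)%N ->
  eqm c (\sum_(0 <= l < i) E l) (\sum_(0 <= l < j) E l) ->
  eqm c 0 (\sum_(i <= l < j) E l).
Proof.
move=> ij [t]; rewrite (big_cat_nat _ ij) //= => /addrI ->.
by exists t; rewrite add0r.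
Qed.

Lemma eqm_iter c F x j :
  (forall a b, eqm c a b -> eqm c (F a) (F b)) ->
  eqm c x (F x) -> eqm c x (iter j F x).
Proof.
move=> cF Fx; elim: j => [|j IH]; first exact: eqm_refl.
exact: eqm_trans Fx (cF _ _ IH).
Qed.

Section Prime.
Variable p : nat.

(* The Jacobian [J] of [F] at [x] is recorded only modulo [p ^ 2], as
   [1 + p A]; composition then simply adds the [A]'s. *)
Definition has_jet F x (A : V -> V) := exists J : {linear V -> V},
  (forall P u, eqm (P ^+ 2) (F x + P *: J u) (F (x + P *: u))) /\
  forall u, eqm (p%:R ^+ 2) (u + p%:R *: A u) (J u).

Definition jets F := forall x, exists A, has_jet F x A.

Lemma has_jet_id x : has_jet id x (fun=> 0).
Proof.
exists idfun; split=> [P u|u]; first exact: eqm_refl.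
by rewrite scaler0 addr0; exact: eqm_refl.
Qed.

Lemma eqm_jacobian A (J : {linear V -> V}) u :
  (forall u, eqm (p%:R ^+ 2) (u + p%:R *: A u) (J u)) -> eqm p%:R u (J u).
Proof.
by move=> /(_ u); rewrite expr2 => /eqmW; apply: eqm_trans; exists (A u).
Qed.

Lemma has_jet_comp F G x A B : has_jet F x A -> has_jet G (F x) B ->
  has_jet (G \o F) x (fun u => A u + B u).
Proof.
move=> [J [FJ JA]] [K [GK KB]]; exists (K \o J)%FUN; split=> [P u /=|u /=].
  have [r ->] := FJ P u.
  have -> : F x + P *: J u + P ^+ 2 *: r = F x + P *: (J u + P *: r).
    by rewrite scalerDr scalerA addrA expr2.
  apply: eqm_trans (GK P _).
  by exists (K r); rewrite (linearD K) (linearZZ K) /= scalerDr scalerA addrA expr2.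
have [e ->] := JA u; rewrite (linearD K) (linearZZ K) /=.
apply: eqm_trans (eqm_add _ _ _).
rewrite (linearD K) (linearZZ K) /= scalerDr [_ *: A u + _]addrC addrA.
apply: eqmD (KB u) _.
(* [K] is 1 modulo [p], so [p K (A u)] is [p A u] modulo [p ^ 2]: the cross term of the product of
   Jacobians vanishes. *)
by rewrite expr2; exact/eqmZ/(eqm_jacobian _ KB).
Qed.

Lemma jets_id : jets id.
Proof. by move=> x; exists (fun=> 0); exact: has_jet_id. Qed.

Lemma jets_comp F G : jets F -> jets G -> jets (G \o F).
Proof.
move=> jF jG x; have [A FA] := jF x; have [B GB] := jG (F x).
by exists (fun u => A u + B u); exact: has_jet_comp.
Qed.

Lemma jets_iter F j : jets F -> jets (iter j F).
Proof.
by move=> jF; elim: j => [|j IH]; [exact: jets_id | exact: jets_comp].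
Qed.

Lemma jets_eqm F c x y : jets F -> eqm c x y -> eqm c (F x) (F y).
Proof.
move=> jF [t ->]; have [A [J [FJ _]]] := jF x.
have /(_ c t) := FJ; rewrite expr2 => /eqmW; apply: eqm_trans.
exact: eqm_add.
Qed.

Lemma has_jet_expand F x A k u : has_jet F x A -> exists s,
  F (x + p%:R ^+ k.+1 *: u) = F x + p%:R ^+ k.+1 *: (u + p%:R *: s).
Proof.
move=> [J [FJ JA]]; have [s Js] := eqm_jacobian u JA.
have [r ->] := FJ (p%:R ^+ k.+1) u.
exists (s + p%:R ^+ k *: r); rewrite -addrA expr2 -scalerA -scalerDr Js.
by rewrite [_ *: (s + _)]scalerDr scalerA -exprS addrA.
Qed.

(** Here [J] is 1 modulo [p ^ 2], and the quadratic error, of order [2 (k + 2)], leaves a relative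
    factor [p ^ 2] because the exponent [k + 2] is at least 2. *)
Lemma has_jet0_expand F x k u : has_jet F x (fun=> 0) -> exists s,
  F (x + p%:R ^+ k.+2 *: u) = F x + p%:R ^+ k.+2 *: (u + p%:R ^+ 2 *: s).
Proof.
move=> [J [FJ JA]]; have [s Js] := JA u.
have [r ->] := FJ (p%:R ^+ k.+2) u.
exists (s + p%:R ^+ k *: r); rewrite -addrA [(_ ^+ k.+2) ^+ 2]expr2 -scalerA.
by rewrite -scalerDr Js scaler0 addr0 [_ *: (s + _)]scalerDr scalerA -exprD addrA.
Qed.

(** Each step adds the same displacement [d] modulo [c], since by hypothesis [F] transports offsets
    from [x] unchanged modulo [c]. *)
Lemma iter_expand c k d F x :
    (forall u, exists s,
      F (x + p%:R ^+ k *: u) = F x + p%:R ^+ k *: (u + c *: s)) ->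
    F x = x + p%:R ^+ k *: d ->
  forall j, exists e, iter j F x = x + p%:R ^+ k *: (d *+ j + c *: e).
Proof.
move=> expF Fx; elim=> [|j [e IH]].
  by exists 0; rewrite mulr0n scaler0 addr0 scaler0 addr0.
rewrite iterS IH; have [s ->] := expF (d *+ j + c *: e).
exists (e + s); rewrite Fx -[LHS]addrA -scalerDr mulrS [c *: (e + s)]scalerDr.
by rewrite !addrA.
Qed.

(** * Rigidity on residue classes of a torsion-free, separated module *)

Hypothesis p_reg : forall u, p%:R *: u = 0 -> u = 0.
Hypothesis p_sep : forall t, (forall m, eqm (p%:R ^+ m) 0 t) -> t = 0.

Lemma pX_inj k u t : p%:R ^+ k *: u = p%:R ^+ k *: t -> u = t.
Proof.
move/eqP; rewrite -subr_eq0 -scalerBr => /eqP E; apply/eqP; rewrite -subr_eq0.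
apply/eqP; elim: k E => [|k IH]; first by rewrite scale1r.
by rewrite exprS -scalerA => /p_reg.
Qed.

Lemma p_inj u t : p%:R *: u = p%:R *: t -> u = t.
Proof. exact: (@pX_inj 1). Qed.

Lemma exact_power t : t <> 0 ->
  exists k d, t = p%:R ^+ k *: d /\ ~ eqm p%:R 0 d.
Proof.
move=> t0.
have ex : exists m, ~~ `[< eqm (p%:R ^+ m) 0 t >].
  apply: contrapT => nex; apply/t0/p_sep => m; apply: contrapT => nm.
  by apply: nex; exists m; apply/asboolP.
case: (ex_minnP ex) => -[|k] /asboolP nk kmin.
  by case: nk; exists t; rewrite scale1r add0r.
have : eqm (p%:R ^+ k) 0 t.
  apply: contrapT => nk'; suff : (k < k)%N by rewrite ltnn.
  by apply: kmin; exact/asboolP.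
move=> [d td]; exists k, d; split; first by rewrite td add0r.
move=> [e de]; apply: nk; exists e.
by rewrite td de !add0r scalerA -exprSr.
Qed.

(** Distinct points of a class differ by [p ^ (k + 1) d] with [d] nonzero modulo [p]; [F] preserves
    this difference modulo [p ^ (k + 2)], so the images differ too. *)
Lemma jets_inj F x y : jets F -> eqm p%:R x y -> F x = F y -> x = y.
Proof.
move=> jF [t ->] E; apply: contrapT => ne.
have [t0|] := pselect (t = 0).
  by apply: ne; rewrite t0 scaler0 addr0.
move=> /exact_power[k [d [td nd]]]; apply: nd.
have [A FA] := jF x; have [s Fs] := has_jet_expand k d FA.
move: E; rewrite td scalerA -exprS Fs => /eqP.
rewrite -[X in X == _]addr0 (inj_eq (addrI _)) => /eqP.
rewrite -[X in X = _](scaler0 _ (p%:R ^+ k.+1)) => /pX_inj ds.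
by apply: eqm_sym; rewrite ds; exact: eqm_add.
Qed.

(** Two iterates coincide by pigeonhole; injectivity on the class of [x] cancels the common initial
    applications of [F]. *)
Lemma periodic_of_finite F x (O : {fset V}) : jets F -> eqm p%:R x (F x) ->
  (forall j, iter j F x \in O) -> exists2 m, (0 < m)%N & iter m F x = x.
Proof.
move=> jF Fx inO.
have [i [j [/andP[ij _] E]]] :=
  pigeonhole_nat (fun j => FSetSub (inO j)).
exists (j - i)%N; first by rewrite subn_gt0.
have {E}/= := congr1 val E.
rewrite -[in iter j](subnKC (ltnW ij)); move: (j - i)%N => m.
elim: i {ij} => [|i IH] /= E; first by [].
apply: IH; apply: jets_inj E => //.
have near k : eqm p%:R x (iter k F x).
  by apply: eqm_iter => // a b; exact: jets_eqm.
exact: eqm_trans (eqm_sym (near _)) (near _).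
Qed.

Lemma has_jet_shift F x y A B : has_jet F x A -> has_jet F y B ->
  eqm (p%:R ^+ 2) x y -> forall u, eqm p%:R (A u) (B u).
Proof.
move=> [J [FJ JA]] [K [FK KB]] [t yt] u.
set q : R := p%:R ^+ 2.
have JK : eqm q (J u) (K u).
  (* The point [x + q (t + u) = y + q u] is expanded both at [x] and at [y]; dividing the comparison
     by [q] gives [J u = K u] modulo [q]. *)
  have [r1 E1] := FJ q (t + u); have [r2 E2] := FK q u.
  have [r3 E3] := FJ q t.
  move: E2; rewrite yt -/q -addrA -scalerDr E1 E3 (linearD J) /= scalerDr.
  rewrite -!addrA => /addrI/addrI; rewrite expr2 -!scalerA -!scalerDr.
  move=> /p_inj/p_inj; rewrite !scalerA -expr2 -/q => E.
  exists (r1 - r3 - r2); rewrite 2!scalerBr !addrA E.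
  by rewrite [_ *: r3 + _]addrC !addrK.
have [t' E] := eqm_trans (JA u) (eqm_trans JK (eqm_sym (KB u))).
exists t'; apply: p_inj.
move: E; rewrite -addrA => /addrI ->.
by rewrite scalerDr scalerA -expr2.
Qed.
Lemma has_jet_eqm F x A B : (forall u, eqm p%:R (A u) (B u)) ->
  has_jet F x A -> has_jet F x B.
Proof.
move=> AB [J [FJ JA]]; exists J; split=> // u; apply: eqm_trans (JA u).
by apply: eqmD; [exact: eqm_refl | rewrite expr2; exact/eqmZ/eqm_sym].
Qed.

(** All iterates of [x] stay in its class modulo [p ^ 2], where the [A] of [F] is constant modulo
    [p], so only zeros are added. *)
Lemma has_jet0_iter F x j : jets F -> has_jet F x (fun=> 0) ->
  eqm (p%:R ^+ 2) x (F x) -> has_jet (iter j F) x (fun=> 0).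
Proof.
move=> jF F0 Fx; elim: j => [|j IH]; first exact: has_jet_id.
have near : eqm (p%:R ^+ 2) x (iter j F x).
  by apply: eqm_iter => // a b; exact: jets_eqm.
have [B FB] := jF (iter j F x).
apply: has_jet_eqm (has_jet_comp IH FB) => u; rewrite add0r.
exact: eqm_sym (has_jet_shift F0 FB near u).
Qed.

Hypothesis p_prime : prime p.

Lemma eqm0_mulrn l d : prime l -> l <> p -> eqm p%:R 0 (d *+ l) -> eqm p%:R 0 d.
Proof.
move=> pl lp [e]; rewrite add0r => E.
have : coprime l p by rewrite prime_coprime // dvdn_prime2 //; exact/eqP.
(* A Bezout relation inverts [l] modulo [p]. *)
move=> /(coprimeP _ (prime_gt0 pl)) [[a b] /= ab].
have {}ab : (a * l = b * p + 1)%N by lia.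
exists (e *+ a - d *+ b); rewrite add0r scalerBr -!scalerMnr -E scaler_nat.
rewrite -!mulrnA (mulnC l) (mulnC p) ab mulrnDr mulr1n.
by rewrite addrC addKr.
Qed.

(** The case [l = p] costs one factor [p], which the modulus [p ^ 2] can afford. *)
Lemma eqm0_mulrn_sq l d : prime l ->
  eqm (p%:R ^+ 2) 0 (d *+ l) -> eqm p%:R 0 d.
Proof.
move=> pl E; have [lp|/eqP lp] := eqVneq l p; last first.
  by apply: eqm0_mulrn lp _ => //; move: E; rewrite expr2 => /eqmW.
move: E => [e]; rewrite lp -scaler_nat add0r expr2 -scalerA => /p_inj ->.
by exists e; rewrite add0r.
Qed.

(** Otherwise some iterate [G] of [F] has a cycle of prime length [l] through [x]. With
    [G x = x + p ^ (k + 2) d], closing the cycle forces [l d] to vanish modulo [p ^ 2], hence [d]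
    modulo [p]. *)
Lemma fixed_of_jet0 F x (O : {fset V}) : jets F -> has_jet F x (fun=> 0) ->
  eqm (p%:R ^+ 2) x (F x) -> (forall j, iter j F x \in O) -> F x = x.
Proof.
move=> jF F0 Fx inO; apply: contrapT => nFx.
have Fx1 : eqm p%:R x (F x) by move: Fx; rewrite expr2 => /eqmW.
have [m m0 Fm] := periodic_of_finite jF Fx1 inO.
have [s [l [pl]]] := iter_prime_period m0 Fm nFx.
have := has_jet0_iter s jF F0 Fx.
have : eqm (p%:R ^+ 2) x (iter s F x).
  by apply: eqm_iter => // a b; exact: jets_eqm.
move: (iter s F) => G [t Gx] G0 nGx Gl.
have t0 : t <> 0 by move=> t0; apply: nGx; rewrite Gx t0 scaler0 addr0.
have [k [d [td nd]]] := exact_power t0.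
rewrite td scalerA -exprD in Gx.
have [e] := iter_expand (fun u => has_jet0_expand k u G0) Gx l.
rewrite Gl -[X in X = _]addr0 => /addrI.
rewrite -[X in X = _](scaler0 _ (p%:R ^+ k.+2)) => /pX_inj E.
by apply: nd; apply: (eqm0_mulrn_sq pl); apply: eqm_sym; exists e.
Qed.

Lemma prime_cycle_length F x l : jets F -> eqm p%:R x (F x) -> F x <> x ->
  prime l -> iter l F x = x -> l = p.
Proof.
move=> jF [t Fx] nFx pl Fl; apply: contrapT => lp.
have t0 : t <> 0 by move=> t0; apply: nFx; rewrite Fx t0 scaler0 addr0.
have [k [d [td nd]]] := exact_power t0.
rewrite td scalerA -exprS in Fx; have [A FA] := jF x.
have [e] := iter_expand (fun u => has_jet_expand k u FA) Fx l.
rewrite Fl -[X in X = _]addr0 => /addrI.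
rewrite -[X in X = _](scaler0 _ (p%:R ^+ k.+1)) => /pX_inj E.
by apply: nd; apply: (eqm0_mulrn pl lp); apply: eqm_sym; exists e.
Qed.
End Prime.

(** Induction on [k] gives [F x = x] modulo [q ^ k]. The iterates are then [x + q ^ k u_j], and two
    of the [u_j] share a residue, at indices whose difference is positive and below [l], hence prime
    to [l]. *)
Lemma fixed_of_long_cycle q (T : finType) (res : V -> T) F x l :
    (forall t, (forall m, eqm (q%:R ^+ m) 0 t) -> t = 0) ->
    (forall a b, res a = res b -> eqm q%:R a b) ->
    (forall c a b, eqm c a b -> eqm c (F a) (F b)) ->
  prime l -> (#|T| < l)%N -> iter l F x = x -> F x = x.
Proof.
move=> q_sep resP cF pl Tl Fl.
suff Fx k : eqm (q%:R ^+ k) x (F x).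
  apply/eqP; rewrite -subr_eq0; apply/eqP/q_sep => m.
  by have [t ->] := Fx m; exists t; rewrite addrC addKr add0r.
elim: k => [|k Fx]; first by exists (F x - x); rewrite scale1r addrC subrK.
have [u uE] := choice (fun j => eqm_iter j (cF _) Fx).
have [i [j [/andP[ij jT] /resP uij]]] := pigeonhole_nat (res \o u).
have cFn n a b : eqm (q%:R ^+ k.+1) a b ->
    eqm (q%:R ^+ k.+1) (iter n F a) (iter n F b).
  by move=> ab; elim: n => //= n; exact: cF.
have : eqm (q%:R ^+ k.+1) (iter i F x) (iter j F x).
  rewrite !uE; apply: eqmD; first exact: eqm_refl.
  by rewrite exprSr; exact: eqmZ.
have l1 := prime_gt1 pl.
(* Further iteration turns the exponent [i] into [i * l], which the period erases; only [j - i]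
   remains. *)
move=> /(cFn (i * l.-1)%N); rewrite -!iterD.
have -> : (i * l.-1 + i = i * l)%N by nia.
have -> : (i * l.-1 + j = (j - i) + i * l)%N by nia.
rewrite [iter (_ + _) _ _]iterD !(iter_fix i Fl) => Ft.
have : coprime (j - i) l.
  rewrite coprime_sym prime_coprime // gtnNdvd ?subn_gt0 //.
  by apply: leq_ltn_trans Tl; rewrite (leq_trans _ jT) // leq_subr.
have ji0 : (0 < j - i)%N by rewrite subn_gt0.
(* As [a (j - i) = b l + 1], repeating the return [a] times amounts to a single application of
   [F]. *)
move=> /(coprimeP _ ji0) [[a b] /= ab].
have {}ab : (a * (j - i) = b * l + 1)%N by lia.
have : eqm (q%:R ^+ k.+1) x (iter (a * (j - i)) F x).
  by rewrite iterM; apply: eqm_iter Ft => c d; exact: cFn.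
by rewrite ab addn1 iterS (iter_fix b Fl).
Qed.
Lemma fixed_of_large_prime p q (T : finType) (res : V -> T) F x (O : {fset V}) :
    (forall u, p%:R *: u = 0 -> u = 0) ->
    (forall t, (forall m, eqm (p%:R ^+ m) 0 t) -> t = 0) -> prime p ->
    (forall t, (forall m, eqm (q%:R ^+ m) 0 t) -> t = 0) ->
    (forall a b, res a = res b -> eqm q%:R a b) -> (#|T| < p)%N ->
    jets p F -> eqm p%:R x (F x) -> (forall j, iter j F x \in O) ->
  F x = x.
Proof.
move=> p_reg p_sep pp q_sep resP Tp jF Fx inO; apply: contrapT => nFx.
have [m m0 Fm] := periodic_of_finite p_reg p_sep jF Fx inO.
have [s [l [pl nG Gl]]] := iter_prime_period m0 Fm nFx.
have jG := jets_iter s jF.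
have Gx : eqm p%:R x (iter s F x).
  by apply: eqm_iter => // a b; exact: jets_eqm.
have lp := prime_cycle_length p_reg p_sep pp jG Gx nG pl Gl.
apply: nG; apply: (fixed_of_long_cycle q_sep resP _ pl _ Gl); last by rewrite lp.
by move=> c a b; exact: jets_eqm.
Qed.
End Jets.

(** * Words in the generators and counting of orbits *)

Section Words.
Variables (Y : choiceType) (S : {fset (Y -> Y)}).

(** The first letter acts first, so the prefixes of a word trace its path from [x]. *)
Definition run (s : seq S) (x : Y) := foldl (fun y (f : S) => val f y) x s.

Lemma run_of_monoid_gen f : monoid_gen S f -> exists s, f =1 run s.
Proof.
elim=> [|{}f fS|{}f g _ [s fs] _ [t gt]]; first by exists [::].
  by exists [:: FSetSub fS].
by exists (t ++ s) => x; rewrite /run foldl_cat /= fs gt.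
Qed.

Lemma monoid_gen_run s : monoid_gen S (run s).
Proof.
elim/last_ind: s => [|s f IH]; first exact: monoid_gen_id.
rewrite (_ : run (rcons s f) = val f \o run s).
  exact: monoid_gen_comp (monoid_gen_in (valP f)) IH.
by apply/funext => x; rewrite /run foldl_rcons.
Qed.

Lemma gen_orbitP x y : gen_orbit S x y <-> exists s, y = run s x.
Proof.
split=> [[f /run_of_monoid_gen[s fs] ->]|[s ->]]; first by exists s.
by exists (run s) => //; exact: monoid_gen_run.
Qed.

(** The labelling may depend on the path and not only on its points, as sums of jets along a path
    do. *)
Definition labelled_by (T : finType) (x : Y) :=
  forall (y : nat -> Y) (f : nat -> Y -> Y) k, y 0%N = x ->
    (forall l, (l < k)%N -> f l \in S /\ y l.+1 = f l (y l)) ->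
  exists lab : nat -> T,
    forall i j, (i < j <= k)%N -> lab i = lab j -> y i = y j.

(** In a shortest word of at least [#|T|] letters two prefixes would share a label, hence an
    endpoint, and the segment between them could be cut out. *)
Lemma short_word (T : finType) (x y : Y) : labelled_by T x ->
  gen_orbit S x y -> exists2 s, (size s < #|T|)%N & y = run s x.
Proof.
move=> labT /gen_orbitP[s0 ys0].
have ex : exists k, `[< exists s, size s = k /\ y = run s x >].
  by exists (size s0); apply/asboolP; exists s0.
case: (ex_minnP ex) => k /asboolP[s [sk ys]] kmin; exists s => //.
rewrite ltnNge; apply/negP => Ts.
(* The default [id] is never reached, as only indices below [size s] occur. *)
pose f l := nth id [seq val g | g <- s] l.
have fP l : (l < size s)%N ->
    f l \in S /\ run (take l.+1 s) x = f l (run (take l s) x).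
  case: s @f {sk ys Ts} => // g s f ls.
  rewrite /f (nth_map g) // (take_nth g) // /run foldl_rcons; split => //.
  exact: valP.
have [|lab labP] := labT (fun i => run (take i s) x) f (size s) _ fP.
  by rewrite take0.
have [i [j [/andP[ij jT] lij]]] := pigeonhole_nat lab.
have js := leq_trans jT Ts.
have E : run (take i s) x = run (take j s) x.
  by apply: labP => //; rewrite ij.
have : (k <= size (take i s ++ drop j s))%N.
  apply: kmin; apply/asboolP; exists (take i s ++ drop j s); split => //.
  by rewrite ys -{1}(cat_take_drop j s) /run !foldl_cat -/(run _ x) -E.
rewrite size_cat size_drop size_takel ?(leq_trans (ltnW ij)) // -sk.
by move: ij js; clear; lia.
Qed.

Lemma card_gen_orbit (T : finType) (x : Y) : labelled_by T x -> S_finite S x ->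
  (#|` fset_set (gen_orbit S x)| <= (#|` S| + 1) ^ (#|T| - 1))%N.
Proof.
move=> labT fin.
pose step (y : Y) (o : option S) := if o is Some f then val f y else y.
pose W : finType := (#|T| - 1).-tuple (option S).
pose O := [fset foldl step x (val w) | w in {: W}]%fset.
have : (fset_set (gen_orbit S x) `<=` O)%fset.
  apply/fsubsetP => y; rewrite in_fset_set // inE => /(short_word labT)[s sT ->].
  (* Padding with idle letters [None] gives all words the same length; this is the source of the
     base [|S| + 1]. *)
  pose w := map some s ++ nseq (#|T| - 1 - size s) None.
  have ws : size w == (#|T| - 1)%N.
    by rewrite size_cat size_map size_nseq; move: sT; clear; lia.
  apply/imfsetP; exists (Tuple ws) => //=; rewrite foldl_cat.
  have -> z m : foldl step z (nseq m None) = z by elim: m.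
  by rewrite /run; elim: s x {w ws sT labT fin O} => //= f s IH x.
move/fsubset_leq_card/leq_trans; apply.
apply: leq_trans (leq_imfset_card _ _ _) _.
by rewrite -cardE card_tuple card_option cardfE addn1.
Qed.
End Words.

(** * First-order Taylor expansion of polynomial functions *)

Section Taylor.
Variables (R : comNzRingType) (n : nat).
Implicit Types (f g : ('I_n -> R) -> R) (x u : 'I_n -> R).

Definition taylor f := forall x, exists D : 'I_n -> R, forall P u,
  exists r, f (fun i => x i + P * u i)
    = f x + P * (\sum_i D i * u i) + P ^+ 2 * r.

Lemma taylor_cst c : taylor (fun=> c).
Proof.
move=> x; exists (fun=> 0) => P u; exists 0.
by rewrite big1 => [|i _]; rewrite ?mul0r // !mulr0 !addr0.
Qed.

Lemma taylor_coord i : taylor (fun x => x i).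
Proof.
move=> x; exists (fun j => (j == i)%:R) => P u; exists 0.
rewrite (bigD1 i) //= eqxx mul1r big1 => [|j /negPf->]; rewrite ?mul0r //.
by rewrite mulr0 !addr0.
Qed.

Lemma taylorD f g : taylor f -> taylor g -> taylor (fun x => f x + g x).
Proof.
move=> tf tg x; have [D fD] := tf x; have [E gE] := tg x.
exists (fun i => D i + E i) => P u.
have [r ->] := fD P u; have [s ->] := gE P u; exists (r + s).
rewrite [in RHS](eq_bigr (fun i => D i * u i + E i * u i)).
  by rewrite big_split /=; ring.
by move=> i _; rewrite mulrDl.
Qed.

Lemma taylorM f g : taylor f -> taylor g -> taylor (fun x => f x * g x).
Proof.
move=> tf tg x; have [D fD] := tf x; have [E gE] := tg x.
exists (fun i => f x * E i + g x * D i) => P u.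
have [r ->] := fD P u; have [s ->] := gE P u.
set a := \sum_i D i * u i; set b := \sum_i E i * u i.
exists (f x * s + a * b + P * (a * s) + r * (g x + P * b + P ^+ 2 * s)).
rewrite [in RHS](eq_bigr (fun i => f x * (E i * u i) + g x * (D i * u i))).
  by rewrite big_split -!big_distrr /= -/a -/b; ring.
by move=> i _; rewrite mulrDl !mulrA.
Qed.

Lemma eq_taylor f g : g =1 f -> taylor f -> taylor g.
Proof. by move=> /funext ->. Qed.

Lemma taylorX f m : taylor f -> taylor (fun x => f x ^+ m).
Proof.
move=> tf; elim: m => [|m IH]; first exact: taylor_cst.
by apply: eq_taylor (taylorM tf IH) => x; rewrite exprS.
Qed.

Lemma taylor_meval (h : {mpoly R[n]}) : taylor (fun x => h.@[x]).
Proof.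
elim/mpolyind: h => [|c m h _ _ IH].
  by apply: eq_taylor (taylor_cst 0) => x; rewrite meval0.
have tm : taylor (fun x => \prod_i x i ^+ m i).
  elim: (index_enum _) => [|i s IHs].
    by apply: eq_taylor (taylor_cst 1) => x; rewrite big_nil.
  apply: eq_taylor (taylorM (taylorX (m i) (taylor_coord i)) IHs) => x.
  by rewrite big_cons.
apply: eq_taylor (taylorD (taylorM (taylor_cst c) tm) IH) => x.
by rewrite mevalD mevalZ mevalX.
Qed.

(** The factor [m] in the linear term is kept explicit: for [m = p] it makes the derivative of
    [x ^ p] divisible by [p]. *)
Lemma expr_taylor (a b P : R) m : (0 < m)%N ->
  exists r, (a + P * b) ^+ m = a ^+ m + P * (m%:R * (a ^+ m.-1 * b) + P * r).
Proof.
case: m => // m _; elim: m => [|m [r IH]].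
  by exists 0; rewrite !expr1 expr0; ring.
exists (r * (a + P * b) + m.+1%:R * a ^+ m * b ^+ 2).
rewrite exprS IH /= !(exprS a) -(natr1 m.+1) -(natr1 m); ring.
Qed.

End Taylor.

(** * Jets of the admissible polynomial maps *)

Section PolynomialMaps.
Variables (R : comNzRingType) (n : nat).

(* The regular module [R^o] provides the scaling that [Zaff] lacks. *)
Local Notation vec := {ffun 'I_n -> R^o}.

Lemma jets_mpoly p (f : vec -> vec) : (0 < p)%N ->
    (forall i, exists g h : {mpoly R[n]}, forall x : vec,
      f x i = x i + p%:R * g.@[x] + h.@[fun j => x j ^+ p]) ->
  jets p f.
Proof.
move=> p0 adm x.
have /choice[g /choice[h fE]] := adm.
have /choice[Dg gE] := fun i => taylor_meval (g i) x.
have /choice[Dh hE] := fun i => taylor_meval (h i) (fun j => x j ^+ p).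
(* By the chain rule [g] and [h] both contribute multiples of [p] to the Jacobian; [A] is their sum
   divided by [p]. *)
pose A (u : vec) : vec :=
  [ffun i => \sum_l (Dg i l + Dh i l * x l ^+ p.-1) * u l].
pose J u : vec := u + p%:R *: A u.
have Jlin : linear J.
  move=> c u v; apply/ffunP => i; rewrite !ffunE /=.
  rewrite [X in _ + p%:R *: X](_ : _ =
    c * (\sum_l (Dg i l + Dh i l * x l ^+ p.-1) * u l)
    + \sum_l (Dg i l + Dh i l * x l ^+ p.-1) * v l); last first.
    rewrite mulr_sumr -big_split /=; apply: eq_bigr => l _.
    by rewrite !ffunE /GRing.scale /=; ring.
  by rewrite /GRing.scale /=; ring.
pose JL : {linear vec -> vec} :=
  HB.pack J (GRing.isLinear.Build _ _ _ _ J Jlin).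
exists A, JL; split=> [P u|u]; last exact: eqm_refl.
have /choice[rg gu] := fun i => gE i P u.
have /choice[rx xu] := fun l => expr_taylor (x l) (u l) P p0.
have /choice[rh hu] := fun i => hE i P
  (fun l => p%:R * (x l ^+ p.-1 * u l) + P * rx l).
exists [ffun i => p%:R * rg i + (\sum_l Dh i l * rx l + rh i)].
apply/ffunP => i; rewrite fE.
rewrite (_ : (fun j => (x + P *: u : vec) j ^+ p)
  = fun l => x l ^+ p + P * (p%:R * (x l ^+ p.-1 * u l) + P * rx l)).
  rewrite (_ : fun_of_fin (x + P *: u) = fun l => x l + P * u l).
    rewrite gu hu !ffunE fE /GRing.scale /=.
    set a := \sum_l Dg i l * u l; set b := \sum_l Dh i l * (x l ^+ p.-1 * u l).
    have -> : \sum_l Dh i l * (p%:R * (x l ^+ p.-1 * u l) + P * rx l)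
        = p%:R * b + P * \sum_l Dh i l * rx l.
      by rewrite !mulr_sumr -big_split; apply: eq_bigr => l _ /=; ring.
    have -> : \sum_l (Dg i l + Dh i l * x l ^+ p.-1) * u l = a + b.
      by rewrite -big_split; apply: eq_bigr => l _ /=; ring.
    by ring.
  by apply/funext => l; rewrite !ffunE.
by apply/funext => l; rewrite !ffunE -xu.
Qed.
(** [A] is not assumed linear, so its vanishing on the basis is extended to all vectors through the
    linear map [J]. *)
Lemma has_jet0_basis p (F : vec -> vec) x A : has_jet p F x A ->
    (forall i, eqm p%:R 0 (A [ffun j => (j == i)%:R])) ->
  has_jet p F x (fun=> 0).
Proof.
move=> [J [FJ JA]] A0; exists J; split=> // u; rewrite scaler0 addr0.
have Je i : eqm (p%:R ^+ 2) [ffun j => (j == i)%:R] (J [ffun j => (j == i)%:R]).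
  apply: eqm_trans (JA _); have [a ->] := A0 i.
  by exists a; rewrite add0r scalerA -expr2.
have /choice[e eE] := Je.
exists (\sum_i u i *: e i).
have uE : u = \sum_i u i *: ([ffun j => (j == i)%:R] : vec).
  apply/ffunP => j; rewrite sum_ffunE.
  rewrite (eq_bigr (fun i => (u i : R) * (j == i)%:R)); last first.
    by move=> i _; rewrite !ffunE.
  rewrite (bigD1 j) //= eqxx mulr1 big1 ?addr0 // => i /negPf ij.
  by rewrite eq_sym ij mulr0.
have -> : J u = \sum_i u i *: J [ffun j => (j == i)%:R].
  by rewrite {1}uE linear_sum; apply: eq_bigr => i _; rewrite linearZ.
rewrite [X in X + _]uE scaler_sumr -big_split; apply: eq_bigr => i _ /=.
by rewrite eE scalerDr !scalerA mulrC.
Qed.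
End PolynomialMaps.

(** * Residues, torsion and separation in Z[1/N] *)

Section Localization.
Variables (N : nat) (N0 : (0 < N)%N).
Local Notation R := (Zloc N).

Lemma ZlocP (a : R) : exists z k, val a = z%:~R / N%:R ^+ k.
Proof. by apply/asboolP; exact: (valP a). Qed.

Lemma Zloc_frac (z : int) k : exists a : R, val a = z%:~R / N%:R ^+ k.
Proof.
have Pa : z%:~R / N%:R ^+ k \in Zloc_pred N by apply/asboolP; exists z, k.
by exists (MkZloc Pa).
Qed.

Let N_neq0 : N%:R != 0 :> rat. Proof. by rewrite pnatr_eq0 -lt0n. Qed.

Lemma Zloc_residue m (a : R) : (0 < m)%N -> coprime m N ->
  exists (c : 'I_m) t, a = (c : nat)%:R + m%:R * t.
Proof.
move=> m0 cop; have [z [k az]] := ZlocP a.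
have Nk0 : N%:R ^+ k != 0 :> rat by rewrite expf_neq0.
have Nk : (0 < N ^ k)%N by rewrite expn_gt0 N0.
have : coprime (N ^ k) m by rewrite coprime_sym coprimeXr.
move=> /(coprimeP _ Nk) [[u v] /= uv].
have {}uv : (u * N ^ k = v * m + 1)%N by lia.
have E := divz_eq (z * u%:Z) m.
have c_ge0 : 0 <= ((z * u%:Z) %% m)%Z by rewrite modz_ge0 //; lia.
have c_lt : (`|((z * u%:Z) %% m)%Z| < m)%N.
  by have := ltz_pmod (z * u%:Z) (_ : 0 < m%:Z); lia.
(* Since [u] inverts [N ^ k] modulo [m], the residue of [z / N ^ k] is that of [z u]; [t] is the
   quotient of [z u] by [m], corrected by [z v / N ^ k]. *)
have [t te] := Zloc_frac (((z * u%:Z) %/ m)%Z * N%:Z ^+ k - z * v%:Z) k.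
exists (Ordinal c_lt), t; apply: val_inj.
rewrite rmorphD rmorphM !rmorph_nat /= te az.
apply: (mulIf Nk0); rewrite divfK // mulrDl -[m%:R * _ * _]mulrA divfK //.
rewrite -[X in _ = X * _ + _](_ : ((z * u%:Z) %% m)%Z%:~R = _); last first.
  by rewrite -[in LHS](gez0_abs c_ge0).
have Eu : u%:R * N%:R ^+ k = v%:R * m%:R + 1 :> rat.
  by rewrite -natrX -!natrM uv natrD.
have Ez : z%:~R * u%:R = ((z * u%:Z) %/ m)%Z%:~R * m%:R + ((z * u%:Z) %% m)%Z%:~R :> rat.
  by rewrite {1}[m%:R]pmulrn [u%:R]pmulrn -!intrM -intrD -E.
have -> : ((z * u%:Z) %% m)%Z%:~R = z%:~R * u%:R - ((z * u%:Z) %/ m)%Z%:~R * m%:R :> rat.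
  by rewrite Ez [RHS]addrC addKr.
rewrite rmorphB !rmorphM rmorphXn /= -!pmulrn.
transitivity (z%:~R * (u%:R * N%:R ^+ k - v%:R * m%:R) : rat).
  by rewrite Eu; ring.
by ring.
Qed.

Lemma Zloc_regular p (a : R) : (0 < p)%N -> p%:R * a = 0 -> a = 0.
Proof.
move=> p0 /(congr1 val); rewrite rmorphM rmorph_nat rmorph0 => /eqP.
rewrite mulf_eq0 pnatr_eq0 -leqn0 leqNgt p0 /= => /eqP a0.
by apply: val_inj; rewrite rmorph0.
Qed.

Lemma Zloc_separated p (a : R) : prime p -> coprime p N ->
  (forall m, exists t, a = p%:R ^+ m * t) -> a = 0.
Proof.
move=> pp cop adiv; have [z [k az]] := ZlocP a.
suff z0 : z = 0 by apply: val_inj; rewrite az z0 mul0r rmorph0.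
(* The exponent [|z|] suffices: [p ^ |z|] exceeds [|z|], so it divides [z] only if [z = 0]. *)
have [t te] := adiv `|z|%N; have [y [l ty]] := ZlocP t.
have Nk0 j : N%:R ^+ j != 0 :> rat by rewrite expf_neq0.
have : z * N%:Z ^+ l = p%:Z ^+ `|z| * y * N%:Z ^+ k.
  apply/eqP; rewrite -(eqr_int rat) !rmorphM !rmorphXn /= -!pmulrn.
  have := congr1 val te; rewrite rmorphM rmorphXn rmorph_nat /= az ty.
  by rewrite mulrA => /eqP; rewrite eqr_div.
move=> /(congr1 absz); rewrite !abszM !abszX !absz_nat => E.
have : (p ^ `|z| %| `|z| * N ^ l)%N by rewrite E -mulnA dvdn_mulr.
rewrite Gauss_dvdl ?coprimeXl ?coprimeXr // => /dvdn_leq dv.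
apply/eqP; rewrite -absz_eq0 eqn0Ngt; apply/negP => /dv.
by rewrite leqNgt ltn_expl ?prime_gt1.
Qed.

Variable n : nat.
Local Notation vec := {ffun 'I_n -> R^o}.

Lemma vec_regular p (u : vec) : (0 < p)%N -> p%:R *: u = 0 -> u = 0.
Proof.
move=> p0 /ffunP E; apply/ffunP => i; have := E i; rewrite !ffunE.
exact: Zloc_regular.
Qed.

Lemma vec_separated p (u : vec) : prime p -> coprime p N ->
  (forall m, eqm (p%:R ^+ m) 0 u) -> u = 0.
Proof.
move=> pp cop E; apply/ffunP => i; rewrite ffunE.
apply: (Zloc_separated pp cop) => m; have [t ->] := E m.
by exists (t i); rewrite !ffunE add0r.
Qed.

Lemma vec_residue m : (0 < m)%N -> coprime m N ->
  exists res : vec -> {ffun 'I_n -> 'I_m},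
    forall a b, res a = res b -> eqm m%:R a b.
Proof.
move=> m0 cop.
have /choice[c cE] := fun a : R => Zloc_residue a m0 cop.
have /choice[q qE] := cE.
exists (fun a => [ffun i => c (a i)]) => a b /ffunP ab.
exists [ffun i => q (b i) - q (a i)]; apply/ffunP => i; rewrite !ffunE.
have := ab i; rewrite !ffunE => E.
rewrite [X in _ = X + _](qE (a i)) [LHS]qE E /GRing.scale /=; ring.
Qed.

End Localization.

(** * Computability of the constant *)

Lemma recursive_comp2 (G : nat -> nat -> nat) k (a b : k.-tuple nat -> nat) :
  computable2 G -> recursive a -> recursive b ->
  recursive (fun v => G (a v) (b v)).
Proof.
move=> cG ra rb.
pose h (i : 'I_2) := if i == ord0 then a else b.
have rh i : recursive (h i) by rewrite /h; case: ifP.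
by apply: recursive_ext (recursive_comp cG rh) _ => v /=; rewrite !tnth_mktuple.
Qed.

Lemma recursive_S k (a : k.-tuple nat -> nat) :
  recursive a -> recursive (fun v => (a v).+1).
Proof.
move=> ra; apply: recursive_ext (recursive_comp recursive_succ (fun=> ra)) _.
by move=> v /=; rewrite /thead tnth_mktuple.
Qed.

Lemma computable2_rec (F : nat -> nat -> nat) (b : nat -> nat)
    (s : nat -> nat -> nat) :
    (forall m, F 0%N m = b m) -> (forall n m, F n.+1 m = s (F n m) m) ->
    recursive (fun v : 1.-tuple nat => b (tnth v ord0)) -> computable2 s ->
  computable2 F.
Proof.
move=> F0 FS rb cs.
(* Primitive recursion passes counter, previous value and parameter in this order; the step reads
   the last two. *)
pose i1 : 'I_3 := Ordinal (isT : 1 < 3)%N; pose i2 : 'I_3 := ord_max.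
have rs := recursive_comp2 cs (recursive_proj i1) (recursive_proj i2).
apply: recursive_ext (recursive_prim rb rs) _ => v /=.
case/tupleP: v => a v; case/tupleP: v => c v.
rewrite theadE !(tnth_nth 0%N) /=.
have : nth 0%N (behead_tuple [tuple of [:: a, c & v]]) 0 = c by [].
move: (behead_tuple _) => w wc.
by elim: a => [|a IH] /=; rewrite ?F0 // FS -IH !(tnth_nth 0%N) /= wc.
Qed.

Lemma computable2_add : computable2 addn.
Proof.
apply: (@computable2_rec _ id (fun r _ => r.+1)) => //.
  exact: recursive_proj.
exact: recursive_S (recursive_proj _).
Qed.

Lemma computable2_mul : computable2 muln.
Proof.
apply: (@computable2_rec _ (fun=> 0%N) addn) => [//|n m||].
- by rewrite mulSn addnC.
- exact: recursive_zero.
- exact: computable2_add.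
Qed.

Lemma computable2_exp : computable2 (fun e m => m ^ e)%N.
Proof.
apply: (@computable2_rec _ (fun=> 1%N) muln) => [//|n m||].
- by rewrite expnSr.
- exact: recursive_S (recursive_zero _).
- exact: computable2_mul.
Qed.

(** This bounds [p ^ (n + n ^ 2)] whenever [p <= (N + 1) ^ n]. *)
Definition orbit_const (n N : nat) := (N.+1 ^ (n * (n + n * n)))%N.

Lemma computable2_orbit_const : computable2 orbit_const.
Proof.
have r0 := recursive_proj (ord0 : 'I_2).
have rnn := recursive_comp2 computable2_mul r0 r0.
have re := recursive_comp2 computable2_mul r0 (recursive_comp2 computable2_add r0 rnn).
exact: recursive_comp2 computable2_exp re (recursive_S (recursive_proj ord_max)).
Qed.

(** * Labels along the paths of a finite orbit *)

Section Orbit.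
Variables (n N p : nat) (S : {fset (Zaff N n -> Zaff N n)}) (x : Zaff N n).
Hypotheses (N0 : (0 < N)%N) (p_prime : prime p) (pN : coprime p N).
Hypothesis S_adm : forall f, f \in S -> admissible p f.
Hypothesis x_fin : S_finite S x.
Local Notation vec := {ffun 'I_n -> (Zloc N)^o}.

Let p_gt0 : (0 < p)%N := prime_gt0 p_prime.

Lemma jets_word F : monoid_gen S F -> jets p (F : vec -> vec).
Proof.
elim=> [|f fS|f g _ jf _ jg].
- exact: jets_id.
- exact: jets_mpoly p_gt0 (S_adm fS).
- exact: jets_comp jg jf.
Qed.

Lemma word_iter F j : monoid_gen S F -> monoid_gen S (iter j F).
Proof.
by move=> wF; elim: j => [|j]; [exact: monoid_gen_id | exact: monoid_gen_comp].
Qed.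

Lemma word_orbit F y j : monoid_gen S F -> gen_orbit S x y ->
  iter j F y \in fset_set (gen_orbit S x).
Proof.
move=> wF [W wW ->]; rewrite in_fset_set // inE.
by exists (iter j F \o W) => //; exact: monoid_gen_comp (word_iter _ wF) wW.
Qed.

Let p_reg (u : vec) : p%:R *: u = 0 -> u = 0.
Proof. exact: vec_regular. Qed.

Let p_sep (u : vec) : (forall m, eqm (p%:R ^+ m) 0 u) -> u = 0.
Proof. exact: vec_separated. Qed.

Lemma word_fixed_of_jet0 (F : vec -> vec) (y : vec) : monoid_gen S F -> gen_orbit S x y ->
  has_jet p F y (fun=> 0) -> eqm (p%:R ^+ 2) y (F y) -> F y = y.
Proof.
move=> wF xy F0 Fy; apply: (fixed_of_jet0 p_reg p_sep p_prime (jets_word wF) F0 Fy).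
by move=> j; exact: word_orbit.
Qed.

Lemma word_fixed_of_large (F : vec -> vec) (y : vec) q :
    prime q -> coprime q N -> (q ^ n < p)%N ->
  monoid_gen S F -> gen_orbit S x y -> eqm p%:R y (F y) -> F y = y.
Proof.
move=> pq qN qp wF xy Fy.
have [res resP] := vec_residue N0 n (prime_gt0 pq) qN.
apply: (fixed_of_large_prime p_reg p_sep p_prime _ resP _ (jets_word wF) Fy).
- by move=> t; exact: vec_separated.
- by rewrite card_ffun !card_ord.
- by move=> j; exact: word_orbit wF xy.
Qed.

(** One family [A] serves all segments, so the jet of a segment is a difference of two partial sums
    from the start. *)
Lemma words_of_path (y : nat -> vec) (f : nat -> vec -> vec) k :
    (forall l, (l < k)%N -> f l \in S /\ y l.+1 = f l (y l)) ->
  exists A : nat -> vec -> vec, forall i j, (i <= j <= k)%N ->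
    exists F : vec -> vec, [/\ monoid_gen S F, F (y i) = y j
      & has_jet p F (y i) (fun u => \sum_(i <= l < j) A l u)].
Proof.
move=> step.
have /choice[A fA] l : exists A, (l < k)%N -> has_jet p (f l) (y l) A.
  have [lk|] := boolP (l < k)%N; last by exists (fun=> 0).
  by have [A fA] := jets_word (monoid_gen_in (step l lk).1) (y l); exists A.
exists A => i j /andP[].
have trivial : exists F : vec -> vec, [/\ monoid_gen S F, F (y i) = y i
    & has_jet p F (y i) (fun u => \sum_(i <= l < i) A l u)].
  exists id; split => //; first exact: monoid_gen_id.
  apply: has_jet_eqm (has_jet_id _ _) => u.
  by rewrite big_geq //; exact: eqm_refl.
elim: j => [|j IH]; first by rewrite leqn0 => /eqP <-.
rewrite leq_eqVlt => /orP[/eqP <- //|ij jk].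
have [F [wF Fy FA]] := IH ij (ltnW jk).
have [fS fy] := step j jk.
exists (f j \o F); split.
- exact: monoid_gen_comp (monoid_gen_in fS) wF.
- by rewrite /= Fy fy.
apply: has_jet_eqm (has_jet_comp FA _); last by rewrite Fy; exact: fA.
by move=> u; rewrite big_nat_recr //; exact: eqm_refl.
Qed.

Lemma path_orbit (y : nat -> vec) (f : nat -> vec -> vec) k i : y 0%N = x ->
    (forall l, (l < k)%N -> f l \in S /\ y l.+1 = f l (y l)) ->
  (i <= k)%N -> gen_orbit S x (y i).
Proof.
move=> y0 step ik; have [A /(_ 0%N i ik)[F [wF Fy _]]] := words_of_path step.
by exists F => //; rewrite -y0.
Qed.

Lemma labelled_by_large q : prime q -> coprime q N -> (q ^ n < p)%N ->
  labelled_by S {ffun 'I_n -> 'I_p} x.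
Proof.
move=> pq qN qp y f k y0 step.
have [res resP] := vec_residue N0 n p_gt0 pN.
have [A words] := words_of_path step.
exists (fun i => res (y i)) => i j /andP[ij jk] /resP yij.
have [|F [wF Fy _]] := words i j; first by rewrite (ltnW ij).
rewrite -Fy; apply/esym/(word_fixed_of_large pq qN qp wF); last by rewrite Fy.
exact: path_orbit y0 step (leq_trans (ltnW ij) jk).
Qed.

Lemma labelled_by_jets :
  labelled_by S ({ffun 'I_n -> 'I_(p ^ 2)}
    * {ffun 'I_n -> {ffun 'I_n -> 'I_p}})%type x.
Proof.
move=> y f k y0 step.
have [res resP] := vec_residue N0 n p_gt0 pN.
have [res2 res2P] : exists res : vec -> {ffun 'I_n -> 'I_(p ^ 2)},
    forall a b, res a = res b -> eqm (p ^ 2)%:R a b.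
  by apply: vec_residue; rewrite ?expn_gt0 ?p_gt0 ?coprimeXl.
have [A words] := words_of_path step.
pose e i : vec := [ffun j => (j == i)%:R].
(* Equal second components make the jet of the segment from [i] to [j] vanish modulo [p] on the
   basis. *)
exists (fun i => (res2 (y i), [ffun m => res (\sum_(0 <= l < i) A l (e m))])).
move=> i j /andP[ij jk] [/res2P yij /ffunP Aij].
have [|F [wF Fy FA]] := words i j; first by rewrite (ltnW ij).
rewrite -Fy; apply/esym/(word_fixed_of_jet0 wF).
- exact: path_orbit y0 step (leq_trans (ltnW ij) jk).
- apply: (has_jet0_basis FA) => m.
  by apply: eqm0_sum_nat (ltnW ij) _; have := Aij m; rewrite !ffunE => /resP.
- by rewrite -natrX Fy.
Qed.
End Orbit.

(** * The bound, by comparing [p] with [q ^ n] *)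

Theorem corollary3 :
  exists C : nat -> nat -> nat, computable2 C /\
    forall (n N p : nat), (0 < n)%N -> (0 < N)%N -> prime p -> ~~ (p %| N)%N ->
    forall S : {fset (Zaff N n -> Zaff N n)},
    (forall f, f \in S -> admissible p f) ->
    forall x : Zaff N n, S_finite S x ->
    (#|` fset_set (gen_orbit S x)|
       <= (C n N * p ^ n * #|` S| + 1) ^ (C n N * p ^ n - 1))%N.
Proof.
exists orbit_const; split; first exact: computable2_orbit_const.
move=> n N p n0 N0 pp npN S S_adm x x_fin.
have pN : coprime p N by rewrite prime_coprime.
have p0 := prime_gt0 pp.
have C0 : (0 < orbit_const n N)%N by rewrite expn_gt0.
have pn0 : (0 < p ^ n)%N by rewrite expn_gt0 p0.
suff [T labT cardT] : exists2 T : finType,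
    labelled_by S T x & (#|T| <= orbit_const n N * p ^ n)%N.
  apply: leq_trans (card_gen_orbit labT x_fin) _.
  apply: (@leq_trans ((orbit_const n N * p ^ n * #|` S| + 1) ^ (#|T| - 1))).
    case: (#|T| - 1)%N => [//|e].
    by rewrite leq_exp2r // leq_add2r leq_pmull // muln_gt0 C0.
  by rewrite leq_pexp2l ?leq_sub2r // addn1.
(* A prime factor of [N + 1] is prime to [N] and at most [N + 1]. *)
pose q := pdiv N.+1.
have pq : prime q by rewrite pdiv_prime.
have qN : coprime q N.
  by apply: coprime_dvdl (pdiv_dvd _) _; rewrite coprime_sym coprimenS.
have qle : (q <= N.+1)%N by rewrite dvdn_leq ?pdiv_dvd.
have [pq_le|qp] := leqP p (q ^ n); last first.
  eexists; first exact: (labelled_by_large N0 pp pN S_adm x_fin pq qN qp).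
  by rewrite card_ffun !card_ord leq_pmull.
eexists; first exact: (labelled_by_jets N0 pp pN S_adm x_fin).
rewrite card_prod !card_ffun !card_ord -!expnM.
(* One factor [p ^ n] is split off to match the bound; the rest is absorbed by the constant through
   [p <= q ^ n <= (N + 1) ^ n]. *)
rewrite -expnD (_ : 2 * n + n * n = (n + n * n) + n)%N; last by lia.
rewrite expnD leq_mul2r; apply/orP; right.
rewrite /orbit_const expnM leq_exp2r ?addn_gt0 ?n0 //.
by apply: leq_trans pq_le _; rewrite leq_exp2r.
Qed.
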